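(* Let $\Gamma$ be a finite abelian group of even order, and let $\sigma$ be an involution of $\Gamma$. Then there exist a positive integer $d$ and a centrally symmetric convex $d$-polytope $P$ in $\mathbb{E}^d$ such that $G(P)=\Gamma(P)=\Gamma$ and $\sigma$ is realized as the central symmetry of $P$; that is, there is an isomorphism $\Gamma\to G(P)$ (with $G(P)\to\Gamma(P)$ also an isomorphism) under which $\sigma$ corresponds to the map $x\mapsto -x$.
   Context: For a convex polytope $P$, $G(P)$ is the group of Euclidean isometries of $\mathbb{E}^d$ preserving $P$, and $\Gamma(P)$ is the group of combinatorial automorphisms of its face lattice; each symmetry induces an automorphism. $P$ is centrally symmetric if $-P=P$ (with respect to the origin). *)

(* Defs.v *)
From HB Require Import structures.
From mathcomp Require Import all_boot all_order all_algebra all_fingroup.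
From mathcomp Require Import boolp classical_sets reals.
Set Implicit Arguments. Unset Strict Implicit. Unset Printing Implicit Defensive.
Import Order.TTheory GRing.Theory Num.Theory.
Local Open Scope ring_scope.
Local Open Scope classical_set_scope.

Definition dotv (R : realType) (d : nat) (x y : 'rV[R]_d) : R :=
  \sum_(i < d) x 0 i * y 0 i.

Definition edist (R : realType) (d : nat) (x y : 'rV[R]_d) : R :=
  Num.sqrt (dotv (x - y) (x - y)).

Definition conv (R : realType) (d : nat) (S : seq 'rV[R]_d) : set 'rV[R]_d :=
  [set x | exists w : 'I_(size S) -> R,
     (forall i, 0 <= w i) /\ \sum_(i < size S) w i = 1 /\
     x = \sum_(i < size S) w i *: S`_i].

(* P is a convex d-polytope in E^d: the convex hull of finitely many points
   whose affine hull is all of E^d (affine dimension d). *)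
Definition dpolytope (R : realType) (d : nat) (P : set 'rV[R]_d) : Prop :=
  exists S : seq 'rV[R]_d,
    P = conv S /\ \rank (\matrix_(i < size S) (S`_i - S`_0)) = d.

Definition centrally_symmetric (R : realType) (d : nat) (P : set 'rV[R]_d) :=
  forall x, P x <-> P (- x).

Definition isometry (R : realType) (d : nat) (f : 'rV[R]_d -> 'rV[R]_d) :=
  forall x y, edist (f x) (f y) = edist x y.

Definition symmetry_of (R : realType) (d : nat) (P : set 'rV[R]_d)
  (f : 'rV[R]_d -> 'rV[R]_d) := isometry f /\ f @` P = P.

(* faces of P (including the empty face and P itself):
   intersections of P with a weakly valid inequality taken with equality *)
Definition face (R : realType) (d : nat) (P F : set 'rV[R]_d) : Prop :=
  exists (a : 'rV[R]_d) (b : R),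
    (forall x, P x -> dotv x a <= b) /\ F = [set x | P x /\ dotv x a = b].

Definition comb_aut (R : realType) (d : nat) (P : set 'rV[R]_d)
  (alpha : set 'rV[R]_d -> set 'rV[R]_d) : Prop :=
  [/\ forall F, face P F -> face P (alpha F),
      forall F', face P F' -> exists2 F, face P F & alpha F = F' &
      forall F F', face P F -> face P F' -> (F `<=` F' <-> alpha F `<=` alpha F')].

Definition induces (R : realType) (d : nat) (P : set 'rV[R]_d)
  (f : 'rV[R]_d -> 'rV[R]_d) (alpha : set 'rV[R]_d -> set 'rV[R]_d) : Prop :=
  forall F, face P F -> alpha F = f @` F.

(* Main.v *)
Require Import Defs.
From HB Require Import structures.
From mathcomp Require Import all_boot all_order all_algebra all_fingroup.
From mathcomp Require Import boolp classical_sets reals.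
From mathcomp Require Import ring lra zify.
Set Implicit Arguments. Unset Strict Implicit. Unset Printing Implicit Defensive.
Import Order.TTheory GRing.Theory Num.Theory.
Local Open Scope ring_scope.

(* Let Y be a finite set with a free involution s.  Identify R^(|Y|/2) with the
   odd functions on Y, with unit vectors e_y = - e_(s y), so that the e_y span a
   cross-polytope.  For a suitable family HH of blocks T (sets of size at least 3
   with T and s T disjoint) add above each face conv(e_y, y in T) a vertex
   proportional to the sum of the e_y, at a height given by the concave gauge
   N(t) = t - eps t (t - 1).  Whether two vertices lie on a common proper face is
   a combinatorial notion: it fails when the two blocks conflict (y in one, s y in
   the other), and it holds for {z} and T as soon as s z is not in T.  This
   recovers Y and HH, so a combinatorial automorphism is a permutation of Y
   preserving HH.

   Given a central involution sigma of a group G, take Y = G * layers with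
   s (x, l) = (sigma x, l) and HH the translates of a few sections of Y -> layers,
   of pairwise different sizes.  One family of sections pins down the layers, and
   makes an automorphism act by the same map rho on every layer; a last twisted
   section {(t l, l)} with t surjective forces rho (t l) = h (t l), so rho is the
   translation by h.  Only the centrality of sigma is used. *)

(** * Faces and isometries *)

Section Euclid.
Local Open Scope classical_set_scope.
Context {R : realType} {d : nat}.
Implicit Types (x y z a : 'rV[R]_d) (f : 'rV[R]_d -> 'rV[R]_d).
Implicit Types (P F : set 'rV[R]_d).

Lemma dotvC x y : dotv x y = dotv y x.
Proof. by apply: eq_bigr => i _; rewrite mulrC. Qed.

Lemma dotvDl x y z : dotv (x + y) z = dotv x z + dotv y z.
Proof. by rewrite -big_split; apply: eq_bigr => i _; rewrite mxE mulrDl. Qed.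

Lemma dotvZl (c : R) x y : dotv (c *: x) y = c * dotv x y.
Proof. by rewrite mulr_sumr; apply: eq_bigr => i _; rewrite mxE mulrA. Qed.

Lemma dotvBl x y z : dotv (x - y) z = dotv x z - dotv y z.
Proof. by rewrite -scaleN1r dotvDl dotvZl mulN1r. Qed.

Lemma dotvBr x y z : dotv z (x - y) = dotv z x - dotv z y.
Proof. by rewrite dotvC dotvBl !(dotvC z). Qed.

Lemma dotv0l x : dotv 0 x = 0.
Proof. by rewrite -(scale0r x) dotvZl mul0r. Qed.

Lemma dotv_suml (I : Type) (r : seq I) (p : pred I) (u : I -> 'rV[R]_d) x :
  dotv (\sum_(i <- r | p i) u i) x = \sum_(i <- r | p i) dotv (u i) x.
Proof.
by elim/big_rec2: _ => [|i v1 v2 _ <-]; rewrite ?dotv0l ?dotvDl.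
Qed.

Lemma dotv_ge0 x : 0 <= dotv x x.
Proof. by apply: sumr_ge0 => i _; rewrite -expr2 sqr_ge0. Qed.

Lemma dotv_eq0 x : dotv x x = 0 -> x = 0.
Proof.
move=> /psumr_eq0P h; apply/rowP => i; rewrite mxE.
by apply/eqP; rewrite -sqrf_eq0 expr2 h // => j _; rewrite -expr2 sqr_ge0.
Qed.

Lemma isometryP f :
  Defs.isometry f <->
  forall x y, dotv (f x - f y) (f x - f y) = dotv (x - y) (x - y).
Proof.
split=> h x y; last by rewrite /edist h.
by apply/eqP; rewrite -eqr_sqrt ?dotv_ge0 //; apply/eqP; apply: h.
Qed.

Lemma isometry_inj f : Defs.isometry f -> injective f.
Proof.
move=> /isometryP h x y e; apply/eqP; rewrite -subr_eq0; apply/eqP/dotv_eq0.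
by rewrite -h e subrr dotv0l.
Qed.

Lemma isometry_dot f x y :
  Defs.isometry f -> dotv (f x - f 0) (f y - f 0) = dotv x y.
Proof.
move=> /isometryP h.
have polar (u v : 'rV[R]_d) :
    dotv u v = (dotv u u + dotv v v - dotv (u - v) (u - v)) / 2.
  by rewrite !(dotvBl, dotvBr) (dotvC v u); field.
rewrite polar [RHS]polar !h !subr0.
have -> : f x - f 0 - (f y - f 0) = f x - f y by rewrite opprB addrA subrK.
by rewrite h.
Qed.

Lemma isometry_face P f F :
  symmetry_of P f -> face P F -> face P (f @` F).
Proof.
move=> [isof fP] [a [b [hb ->]]].
(* The new normal is [a] under the linear part of [f]; the level is corrected by the translation
   [f 0]. *)
exists (f a - f 0), (b + dotv (f 0) (f a - f 0)).
have dotf x : dotv (f x) (f a - f 0) = dotv x a + dotv (f 0) (f a - f 0).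
  by rewrite -(isometry_dot x a isof) (dotvBl (f x)) subrK.
split=> [y|]; first by rewrite -{1}fP => -[x Px <-]; rewrite dotf lerD2r hb.
apply/seteqP; split=> [_ [x [Px xa] <-]|y []] /=.
  by rewrite dotf xa -{1}fP; split=> //; exists x.
by rewrite -{1}fP => -[x Px <-]; rewrite dotf => /addIr xa; exists x.
Qed.

(** * Faces of the convex hull of a finite set *)

Section Hull.
Variable S : seq 'rV[R]_d.

Lemma mem_conv x : x \in S -> conv S x.
Proof.
move=> xS; have iS := xS; rewrite -index_mem in iS.
exists (fun i => (i == Ordinal iS)%:R); split=> [i|]; first exact: ler0n.
split.
  by rewrite (bigD1 (Ordinal iS)) //= eqxx big1 ?addr0 // => i /negPf ->.
rewrite (bigD1 (Ordinal iS)) //= eqxx big1 => [|i /negPf ->]; last first.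
  by rewrite scale0r.
by rewrite addr0 scale1r nth_index.
Qed.

(** The nonnegative slacks of the points of [S], weighted by [w], sum to zero, so each point of
    nonzero weight has slack zero. *)
Lemma conv_tight (w : 'I_(size S) -> R) x a b :
  (forall i, 0 <= w i) -> \sum_i w i = 1 -> x = \sum_i w i *: S`_i ->
  (forall y, conv S y -> dotv y a <= b) -> dotv x a = b ->
  forall i, w i != 0 -> dotv S`_i a = b.
Proof.
move=> w0 w1 -> le xab i wi.
have Sb (j : 'I_(size S)) : dotv S`_j a <= b by apply/le/mem_conv/mem_nth.
have : \sum_i w i * (b - dotv S`_i a) = 0.
  under eq_bigr do rewrite mulrBr; rewrite sumrB -mulr_suml w1 mul1r -xab.
  by rewrite dotv_suml; under eq_bigr do rewrite dotvZl; rewrite subrr.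
have s0 j : true -> 0 <= w j * (b - dotv S`_j a).
  by move=> _; rewrite mulr_ge0 ?subr_ge0.
move=> /(psumr_eq0P s0)/(_ i isT)/eqP.
by rewrite mulf_eq0 (negPf wi) subr_eq0 => /eqP/esym.
Qed.

Lemma face_vertex F x : face (conv S) F -> F x -> exists2 v, v \in S & F v.
Proof.
move=> [a [b [le ->]]] [[w [w0 [w1 xw]]] xab].
have [i wi] : exists i, w i != 0.
  apply: contrapT => /forallNP h; have := w1; rewrite big1 => [/eqP|i _].
    by rewrite eq_sym oner_eq0.
  by apply/eqP; apply: contrapT => wi; apply: (h i); apply/negP.
exists S`_i; first exact: mem_nth.
split; first exact/mem_conv/mem_nth.
exact: conv_tight w0 w1 xw le xab i wi.
Qed.

(** A convex representation of a point of a face only uses points of [S] on that face, so faces can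
    be compared on [S] alone. *)
Lemma face_sub F F' : face (conv S) F -> face (conv S) F' ->
  (forall v, v \in S -> F v -> F' v) -> F `<=` F'.
Proof.
move=> [a [b [le ->]]] [a' [b' [le' ->]]] sub x [Px xab]; split=> //.
have [w [w0 [w1 xw]]] := Px.
rewrite xw dotv_suml -[RHS]mul1r -w1 mulr_suml; apply: eq_bigr => i _.
have Si : S`_i \in S by rewrite mem_nth.
rewrite dotvZl; have [-> | wi] := eqVneq (w i) 0; first by rewrite !mul0r.
congr (_ * _); apply: (proj2 (sub _ Si _)); split; first exact: mem_conv.
exact: conv_tight w0 w1 xw le xab i wi.
Qed.

Lemma conv_dot_le x a b :
  (forall v, v \in S -> dotv v a <= b) -> conv S x -> dotv x a <= b.
Proof.
move=> le [w [w0 [w1 ->]]]; rewrite dotv_suml -[leRHS]mul1r -w1 mulr_suml.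
apply: ler_sum => i _; rewrite dotvZl ler_wpM2l //.
exact/le/mem_nth.
Qed.

Lemma exposed_face v a b : v \in S -> dotv v a = b ->
  (forall u, u \in S -> u != v -> dotv u a < b) -> face (conv S) [set v].
Proof.
move=> vS vab lt.
have le y : conv S y -> dotv y a <= b.
  apply: conv_dot_le => u uS; have [->|/lt/ltW] := eqVneq u v; last exact.
  by rewrite vab.
exists a, b; split=> //; apply/seteqP; split=> [_ -> |x [Px xab]] /=.
  by split=> //; apply: mem_conv.
have [w [w0 [w1 xw]]] := Px.
rewrite xw -[v]scale1r -w1 scaler_suml; apply: eq_bigr => i _.
have [-> | wi] := eqVneq (w i) 0; first by rewrite !scale0r.
congr (_ *: _); apply/eqP; apply: contraT => /(lt _ (mem_nth _ (ltn_ord i))).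
by rewrite (conv_tight w0 w1 xw le xab) // ltxx.
Qed.

Lemma conv_comb (I : finType) (w : I -> R) (x : I -> 'rV[R]_d) :
  (forall i, 0 <= w i) -> \sum_i w i = 1 -> (forall i, conv S (x i)) ->
  conv S (\sum_i w i *: x i).
Proof.
move=> w0 w1 /choice[u hu].
exists (fun k => \sum_i w i * u i k); split=> [k|].
  by apply: sumr_ge0 => i _; rewrite mulr_ge0 //; have [] := hu i.
split.
  rewrite exchange_big /= -[RHS]w1; apply: eq_bigr => i _.
  by rewrite -mulr_sumr; have [_ [-> _]] := hu i; rewrite mulr1.
under [RHS]eq_bigr do rewrite scaler_suml.
rewrite exchange_big /=; apply: eq_bigr => i _.
have [_ [_ {1}->]] := hu i; rewrite scaler_sumr.
by apply: eq_bigr => k _; rewrite scalerA.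
Qed.

Lemma face_full P : face P P.
Proof.
exists 0, 0; split=> [x _|]; first by rewrite dotvC dotv0l.
by apply/seteqP; split=> [x Px|x []//]; split=> //; rewrite dotvC dotv0l.
Qed.

End Hull.
End Euclid.

(** * Recovering the block system *)

Section Recover.
Variables (Y : finType) (s : Y -> Y) (HH : {set {set Y}}).
Hypotheses (sK : involutive s) (s_neq : forall y, s y != y).
Hypothesis HH_gt2 : forall T, T \in HH -> (2 < #|T|)%N.
Hypothesis HH_anti : forall T y, T \in HH -> y \in T -> s y \notin T.

Definition blocks : {set {set Y}} := ([set [set y] | y : Y] :|: HH)%SET.

Lemma set1_blocks y : [set y]%SET \in blocks.
Proof. by rewrite inE imset_f. Qed.

Lemma set1_notin_HH y : [set y]%SET \notin HH.
Proof. by apply/negP => /HH_gt2; rewrite cards1. Qed.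

Lemma blocksP T : T \in blocks -> (exists y, T = [set y]%SET) \/ T \in HH.
Proof. by rewrite inE => /orP[/imsetP[y _ ->]|]; [left; exists y|right]. Qed.

Lemma blocks_anti T y : T \in blocks -> y \in T -> s y \notin T.
Proof.
by move=> /blocksP[[z ->]|TH yT]; [rewrite !inE => /eqP ->|exact: HH_anti].
Qed.

(** Abstracts lying on a common proper face. The two hypotheses say nothing about two blocks of [HH]
    without a conflict; singletons against blocks carry enough information. *)
Variable comp : rel {set Y}.
Hypothesis comp_conflict : forall T T' y, T \in blocks -> T' \in blocks ->
  y \in T -> s y \in T' -> ~~ comp T T'.
Hypothesis comp_set1 : forall z T, T \in blocks -> s z \notin T ->
  comp [set z]%SET T.

Variable p : {set Y} -> {set Y}.
Hypothesis p_blocks : {in blocks, forall T, p T \in blocks}.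
Hypothesis p_inj : {in blocks &, injective p}.
Hypothesis p_comp : {in blocks &, forall T T', comp T T' -> comp (p T) (p T')}.

Lemma comp_set1E z T : T \in blocks -> comp [set z]%SET T = (s z \notin T).
Proof.
move=> TB; apply/idP/idP => [|/comp_set1]; last exact.
by apply: contraL => szT; apply: (comp_conflict (y := z)) => //;
  rewrite ?set1_blocks ?inE.
Qed.

Lemma p_surj T : T \in blocks -> exists2 T', T' \in blocks & p T' = T.
Proof.
have sub : p @: blocks \subset blocks.
  by apply/fintype.subsetP => _ /imsetP[T' T'B ->]; apply: p_blocks.
have /eqP pB : p @: blocks == blocks by rewrite eqEcard sub card_in_imset ?leqnn.
by rewrite -{1}pB => /imsetP[T' T'B ->]; exists T'.
Qed.

(** The map induced by [p] is injective on the finite set of compatible pairs, hence onto, so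
    compatibility is also reflected. *)
Lemma p_compE : {in blocks &, forall T T', comp (p T) (p T') = comp T T'}.
Proof.
pose A := [set q | [&& q.1 \in blocks, q.2 \in blocks & comp q.1 q.2]]%SET.
have AE q : (q \in A) = [&& q.1 \in blocks, q.2 \in blocks & comp q.1 q.2].
  by rewrite inE.
pose f (q : {set Y} * {set Y}) := (p q.1, p q.2).
have fA : f @: A == A.
  rewrite eqEcard card_in_imset ?leqnn ?andbT.
    apply/fintype.subsetP => _ /imsetP[[T T'] /[1!AE]/= /and3P[TB T'B c] ->].
    by rewrite AE /= !p_blocks //= p_comp.
  move=> [T1 T2] [T3 T4]; rewrite !AE /= => /and3P[B1 B2 _] /and3P[B3 B4 _].
  by case=> /p_inj-> // /p_inj->.
move=> T T' TB T'B; apply/idP/idP => [c|]; last exact: p_comp.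
have : (p T, p T') \in A by rewrite AE /= !p_blocks.
rewrite -(eqP fA) => /imsetP[[T1 T2] /[1!AE]/= /and3P[B1 B2 c']].
by case=> /p_inj-> // /p_inj->.
Qed.

(* The block T is incompatible with everything that {y} is incompatible with,
   for each y in T, whereas a singleton dominates no other vertex. *)
Definition dominating T := [exists T' in blocks,
  (T' != T) && [forall V in blocks, ~~ comp T' V ==> ~~ comp T V]].

Lemma dominating_p T : T \in blocks -> dominating (p T) = dominating T.
Proof.
move=> TB; apply/exists_inP/exists_inP => -[T' T'B /andP[neq /forall_inP h]].
  have [T1 T1B e] := p_surj T'B; exists T1 => //.
  apply/andP; split; first by apply: contraNneq neq => <-; rewrite e.
  apply/forall_inP => V VB; rewrite -(p_compE T1B VB) -(p_compE TB VB) e.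
  exact/h/p_blocks.
exists (p T'); first exact: p_blocks.
apply/andP; split; first by apply: contraNneq neq => /p_inj ->.
apply/forall_inP => V VB; have [W WB <-] := p_surj VB.
by rewrite !p_compE //; apply: h.
Qed.

Lemma dominatingE T : T \in blocks -> dominating T = (T \in HH).
Proof.
move=> TB; apply/exists_inP/idP => [[T' T'B /andP[neq /forall_inP h]]|TH].
  have [[y Ty]|//] := blocksP TB.
  have nc V : V \in blocks -> ~~ comp T' V -> s y \in V.
    by move=> VB c; have := implyP (h _ VB) c; rewrite Ty comp_set1E // negbK.
  (* A point [z] of [T'] makes [T'] conflict with [{s z}], so [s y] lies in [{s z}]. *)
  have sub z : z \in T' -> z = y.
    move=> zT'; apply: (can_inj sK); apply/esym/eqP.
    have := nc [set s z]%SET (set1_blocks _); rewrite inE; apply.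
    by apply: (comp_conflict (y := z)) => //; rewrite ?set1_blocks ?inE.
  have T'sub : T' \subset [set y]%SET.
    by apply/fintype.subsetP => z /sub ->; rewrite inE.
  move: T'sub neq; rewrite Ty subset1 => /orP[/eqP->|]; rewrite ?eqxx //.
  move=> /eqP T'0; rewrite T'0 in T'B.
  by case: (blocksP T'B) => [[z /finset.setP/(_ z)]|/HH_gt2];
    rewrite ?inE ?eqxx ?cards0.
have [y yT] : exists y, y \in T.
  by apply/finset.set0Pn; rewrite -card_gt0 (ltn_trans _ (HH_gt2 TH)).
exists [set y]%SET; first exact: set1_blocks.
apply/andP; split; first by apply: contraTneq TH => <-; apply: set1_notin_HH.
apply/forall_inP => V VB; rewrite comp_set1E // negbK; apply/implyP => syV.
exact: comp_conflict syV.
Qed.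

(** The singletons are the non-dominating blocks, so [p] maps them to one another and defines [rho].
    Membership of [y] in [T] is incompatibility of [{s y}] with [T], which extends [rho] to all
    blocks. *)
Theorem blocks_recover : exists rho : Y -> Y,
  [/\ injective rho, {in blocks, forall T : {set Y}, p T = (rho @: T)%SET} &
      {in HH, forall T : {set Y}, (rho @: T)%SET \in HH}].
Proof.
have p1 y : exists z, p [set y]%SET == [set z]%SET.
  have [[z ->]|] := blocksP (p_blocks (set1_blocks y)); first by exists z.
  rewrite -dominatingE ?p_blocks ?set1_blocks // dominating_p ?set1_blocks //.
  by rewrite dominatingE ?set1_blocks // (negPf (set1_notin_HH y)).
pose rho y := xchoose (p1 y).
have rhoE y : p [set y]%SET = [set rho y]%SET by apply/eqP/(xchooseP (p1 y)).
have rho_inj : injective rho.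
  move=> y z e; apply: set1_inj; apply: p_inj; rewrite ?set1_blocks //.
  by rewrite !rhoE e.
have rho_s y : s (rho (s y)) = rho y.
  have : ~~ comp (p [set s y]%SET) (p [set y]%SET).
    by rewrite p_compE ?set1_blocks // comp_set1E ?set1_blocks // inE sK eqxx.
  by rewrite !rhoE comp_set1E ?set1_blocks // inE negbK => /eqP.
have memE T y : T \in blocks -> (rho y \in p T) = (y \in T).
  move=> TB; rewrite -[RHS]negbK -{2}[y]sK -comp_set1E //.
  rewrite -p_compE ?set1_blocks // rhoE comp_set1E ?p_blocks // negbK.
  by rewrite rho_s.
have pE : {in blocks, forall T : {set Y}, p T = (rho @: T)%SET}.
  move=> T TB; apply/finset.setP => z; have [y <-] : exists y, rho y = z.
    by have [g _ gK] := injF_bij rho_inj; exists (g z).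
  by rewrite memE // mem_imset.
exists rho; split=> // T TH; have TB : T \in blocks by rewrite inE TH orbT.
by rewrite -pE // -dominatingE ?p_blocks // dominating_p ?dominatingE.
Qed.

End Recover.

(** * A rigid block system on a group *)

Section Lines.
Variables (G : finGroupType) (sigma : G).
Hypotheses (sigma2 : (sigma * sigma = 1)%g) (sigma1 : sigma != 1%g).

(** Large enough for [twist] to run through [G], and a multiple of 3, so that sizes modulo 3
    separate the three kinds of colors. *)
Definition width := (3 * #|G|)%N.
Definition layer : finType := ('I_width.+1 * 'I_3)%type.
Definition color : finType := option (option 'I_width.+1).
Definition site : finType := (G * layer)%type.

(* The initial segments have size 0 mod 3; the other two sets of layers have
   sizes 2 and 1 mod 3, so the size of a line determines its color. *)
Definition layers (j : color) : {set layer} :=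
  match j with
  | Some (Some k) => [set l : layer | (l.1 <= k)%N]%SET
  | Some None => [set l : layer | l.2 != 0 :> nat]%SET
  | None => [set l : layer | l.2 == 1 :> nat]%SET
  end.

(** The rows of index below [#|G|] list all of [G]; the default 1 fills the rows after them. *)
Definition twist (j : color) (l : layer) : G :=
  if j is None then nth 1%g (enum G) l.1 else 1%g.

Definition line (g : G) (j : color) : {set site} :=
  [set y : site | (y.2 \in layers j) && (y.1 == g * twist j y.2)%g]%SET.

Definition lines : {set {set site}} :=
  [set line q.1 q.2 | q : (G * color)%type]%SET.

Definition antipode (y : site) : site := (sigma * y.1, y.2)%g.
Definition translate (h : G) (y : site) : site := (h * y.1, y.2)%g.

Lemma G_gt1 : (1 < #|G|)%N.
Proof.
have <- : #|[set sigma; 1%g]%SET| = 2%N by rewrite cards2 sigma1.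
exact: max_card.
Qed.

Lemma width_gt5 : (5 < width)%N.
Proof. by have := G_gt1; rewrite /width; case: #|G| => [|[|n]] // _; lia. Qed.

Lemma linesP T : reflect (exists g j, T = line g j) (T \in lines).
Proof.
apply: (iffP imsetP) => [[[g j] _ ->]|[g [j ->]]]; first by exists g, j.
by exists (g, j).
Qed.

Lemma antipodeK : involutive antipode.
Proof. by move=> [x l]; rewrite /antipode /= mulgA sigma2 mul1g. Qed.

Lemma antipode_neq y : antipode y != y.
Proof.
by case: y => x l; rewrite xpair_eqE eqxx andbT -{2}[x]mul1g (inj_eq (mulIg x)).
Qed.

Lemma card_line g j : #|line g j| = #|layers j|.
Proof.
rewrite -(card_imset (mem (layers j)) (f := fun l => (g * twist j l, l)%g)).
  apply: eq_card => -[x l]; rewrite inE /=; apply/andP/imsetP => /=.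
    by move=> [lj /eqP ->]; exists l.
  by move=> [l' lj [-> ->]].
by move=> l l' [].
Qed.

Lemma card_chain k : #|layers (Some (Some k))| = (3 * k.+1)%N.
Proof.
have -> : layers (Some (Some k)) =
  finset.setX [set i : 'I_width.+1 | (i <= k)%N]%SET [set: 'I_3]%SET.
  by apply/finset.setP => l; rewrite !inE andbT.
rewrite cardsX cardsT card_ord mulnC; congr (_ * _)%N.
rewrite cardsE -sum1_card -(big_mkord (fun i => i <= k)%N (fun=> 1%N)).
have <- := @big_nat_widen _ _ addn 0%N k.+1 _ predT (fun=> 1%N) (ltn_ord k).
by rewrite sum_nat_const_nat muln1 subn0.
Qed.

Lemma card_column (p : pred 'I_3) :
  #|[set l : layer | p l.2]%SET| = (width.+1 * #|p|)%N.
Proof.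
have -> : [set l : layer | p l.2]%SET = finset.setX [set: _]%SET [set i | p i]%SET.
  by apply/finset.setP => l; rewrite !inE.
by rewrite cardsX cardsT card_ord cardsE.
Qed.

Lemma card_twisted : #|layers None| = width.+1.
Proof.
rewrite (card_column (fun i => i == 1 :> nat)).
have -> : #|(fun i : 'I_3 => i == 1 :> nat)| = 1%N; last by rewrite muln1.
by rewrite -sum1_card big_mkcond !big_ord_recl big_ord0.
Qed.

Lemma card_flat : #|layers (Some None)| = (2 * width.+1)%N.
Proof.
rewrite (card_column (fun i => i != 0 :> nat)).
have -> : #|(fun i : 'I_3 => i != 0 :> nat)| = 2%N; last by rewrite mulnC.
by rewrite -sum1_card big_mkcond !big_ord_recl big_ord0.
Qed.

Definition card_layers := (card_chain, card_twisted, card_flat).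

Lemma layers_gt2 j : (2 < #|layers j|)%N.
Proof. by have := width_gt5; case: j => [[k|]|]; rewrite card_layers; lia. Qed.

Lemma card_layers_inj : injective (fun j => #|layers j|).
Proof.
have [N wN] : exists N, width = (3 * N)%N by exists #|G|.
move=> [[i|]|] [[j|]|] //=; rewrite !card_layers.
- by move/eqP; rewrite eqn_mul2l eqSS => /eqP/val_inj->.
all: by rewrite ?wN; first [move: (nat_of_ord i) | move: (nat_of_ord j) | idtac]; lia.
Qed.

Lemma gt1_setD (T : finType) (A B : {set T}) x y : x \in A -> y \in A ->
  x \notin B -> y \notin B -> x != y -> (1 < #|A :\: B|)%N.
Proof.
move=> xA yA xB yB xy; have <- : #|[set x; y]%SET| = 2%N by rewrite cards2 xy.
by apply/subset_leq_card/fintype.subsetP => z /set2P[]->;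
  rewrite inE ?xA ?yA ?xB ?yB.
Qed.

(** Each possible case exhibits two explicit layers. The bound excludes a block that is at least as
    large as another and has a single point outside it, the delicate case of [compatible_face]. *)
Lemma layers_diff i j : i != j -> (#|layers i| <= #|layers j|)%N ->
  (1 < #|layers j :\: layers i|)%N.
Proof.
have w5 := width_gt5; pose c k : 'I_3 := inord k.
have cE k : (k < 3)%N -> c k = k :> nat by move=> ?; rewrite inordK.
pose r k : 'I_width.+1 := inord k.
have rE k : (k < width.+1)%N -> r k = k :> nat by move=> ?; rewrite inordK.
have rc k k' a a' : (k < width.+1)%N -> (k' < width.+1)%N ->
    (a < 3)%N -> (a' < 3)%N -> (k != k') || (a != a') ->
    (r k, c a) != (r k', c a').
  move=> *; rewrite xpair_eqE -!val_eqE /= !rE ?cE //; lia.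
case: i => [[[i lei]|]|]; case: j => [[[j lej]|]|] //;
  rewrite ?card_layers => ne /= le.
- have ltij : (i < j)%N.
    rewrite ltn_neqAle; apply/andP; split; last lia.
    by apply: contraNneq ne => eij; apply/eqP; do 2!congr Some; apply: val_inj.
  by apply: (@gt1_setD _ _ _ (r j, c 0%N) (r j, c 1%N));
    rewrite ?inE /= ?rE ?cE ?rc //; lia.
- by apply: (@gt1_setD _ _ _ (r width, c 1%N) (r width, c 2%N));
    rewrite ?inE /= ?rE ?cE ?rc //; lia.
- by apply: (@gt1_setD _ _ _ (r width, c 1%N) (r width.-1%N, c 1%N));
    rewrite ?inE /= ?rE ?cE ?rc // ?ltnS ?leq_pred //; lia.
- by apply: (@gt1_setD _ _ _ (r 0%N, c 0%N) (r 1%N, c 0%N));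
    rewrite ?inE /= ?rE ?cE ?rc //; lia.
(* The flat set is twice as large as the twisted one, against [le]. *)
- lia.
- by apply: (@gt1_setD _ _ _ (r 0%N, c 0%N) (r 1%N, c 0%N));
    rewrite ?inE /= ?rE ?cE ?rc //; lia.
- by apply: (@gt1_setD _ _ _ (r 0%N, c 2%N) (r 1%N, c 2%N));
    rewrite ?inE /= ?rE ?cE ?rc //; lia.
Qed.

Lemma lines_gt2 T : T \in lines -> (2 < #|T|)%N.
Proof. by move=> /linesP[g [j ->]]; rewrite card_line layers_gt2. Qed.

Lemma lines_anti T y : T \in lines -> y \in T -> antipode y \notin T.
Proof.
move=> /linesP[g [j ->]]; rewrite !inE => /andP[-> /eqP/= <-] /=.
by rewrite -{2}[y.1]mul1g (inj_eq (mulIg _)).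
Qed.

Lemma lines_diff T T' : T \in lines -> T' \in lines -> T != T' ->
  (#|T| <= #|T'|)%N -> (1 < #|T' :\: T|)%N.
Proof.
move=> /linesP[g [i ->]] /linesP[h [j ->]] ne; rewrite !card_line => le.
have [eij|nij] := eqVneq i j.
  rewrite -eij in ne *; have gh : g != h by apply: contraNneq ne => ->.
  have -> : (line h i :\: line g i)%SET = line h i.
    apply/finset.setDidPl; rewrite -finset.setI_eq0; apply/eqP/finset.setP => y.
    rewrite !inE; apply/negP => /andP[/andP[_ /eqP->] /andP[_]].
    by rewrite (inj_eq (mulIg _)) eq_sym (negPf gh).
  by rewrite card_line ltnW ?layers_gt2.
apply: leq_trans (layers_diff nij le) _.
rewrite -(card_imset (mem (layers j :\: layers i)%SET)
                     (f := fun l => (h * twist j l, l)%g)); last first.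
  by move=> l l' [].
apply/subset_leq_card/fintype.subsetP => _ /imsetP[l /[!inE]/andP[li lj] ->] /=.
by rewrite (negPf li) lj eqxx.
Qed.

Lemma imset_translate_line h g j :
  (translate h @: line g j)%SET = line (h * g) j.
Proof.
apply/finset.setP => -[x l]; rewrite inE /=; apply/imsetP/andP => /=.
  by move=> [[x' l'] /[!inE]/= /andP[lj /eqP ->] [-> ->]]; rewrite mulgA.
move=> [lj /eqP ->]; exists (g * twist j l, l)%g;
  first by rewrite !inE /= lj eqxx.
by rewrite /translate /= mulgA.
Qed.

Lemma translate_lines h T : T \in lines -> (translate h @: T)%SET \in lines.
Proof.
move=> /linesP[g [j ->]]; rewrite imset_translate_line.
by apply/linesP; exists (h * g)%g, j.
Qed.

(** The initial segments at the two rows compare the rows both ways; the other two sets of layers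
    tell the three columns apart. *)
Lemma layers_separates l l' :
  (forall j, (l \in layers j) = (l' \in layers j)) -> l = l'.
Proof.
case: l l' => [k a] [k' a'] h; congr pair; apply: val_inj => /=.
  have := h (Some (Some k)); have := h (Some (Some k')).
  by rewrite !inE /= !leqnn; lia.
have := h None; have := h (Some None); rewrite !inE /=.
by case: a {h} => [[|[|[|a]]] // ?]; case: a' => [[|[|[|a']]] // ?].
Qed.

Lemma lines_rigid rho : injective rho ->
  {in lines, forall T : {set site}, (rho @: T)%SET \in lines} ->
  exists h, rho =1 translate h.
Proof.
move=> rho_inj rho_lines.
(* An injective image has the same size, and the size of a line determines its color. *)
have img g j : exists h, (rho @: line g j)%SET = line h j.
  have /rho_lines/linesP[h [i e]] : line g j \in lines by apply/linesP; exists g, j.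
  exists h; rewrite e; congr line; apply: card_layers_inj => /=.
  by rewrite -(card_line h) -e card_imset // card_line.
have layerE y : (rho y).2 = y.2.
  apply: layers_separates => j.
  (* [W] is the union of all lines of color [j], so [rho] maps it onto itself. *)
  pose W := [set z : site | z.2 \in layers j]%SET.
  have WE z : (z \in W) = (z.2 \in layers j) by rewrite inE.
  have /eqP rhoW : rho @: W == W.
    rewrite eqEcard card_imset // leqnn andbT.
    apply/fintype.subsetP => w /imsetP[z zW wz]; move: zW; rewrite wz !WE => zj.
    have [h /finset.setP/(_ (rho z))] := img (z.1 * (twist j z.2)^-1)%g j.
    by rewrite mem_imset // !inE mulgKV eqxx zj /= => /esym/andP[].
  by rewrite -!WE -{1}rhoW mem_imset.
have rowE x l l' : (rho (x, l)).1 = (rho (x, l')).1.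
  (* The last initial segment consists of all layers, so its lines are the full fibres over the
     elements of [G]. *)
  have [h /finset.setP e] := img x (Some (Some ord_max)).
  have first l0 : (rho (x, l0)).1 = h.
    have := e (rho (x, l0)).
    rewrite mem_imset // !inE /= !mulg1 eqxx !leq_ord /=.
    by move/esym/eqP.
  by rewrite !first.
have [h /finset.setP e] := img 1%g None.
exists h => -[x l]; rewrite /translate /= [LHS]surjective_pairing layerE /=.
congr pair.
(* A layer of the twisted set where the twist equals [x]: the image of the twisted line through 1
   prescribes the first coordinate [h * x] there. *)
pose l0 : layer := (inord (index x (enum G)), inord 1).
have ltx : (index x (enum G) < #|G|)%N by rewrite cardE index_mem mem_enum.
have ltw : (index x (enum G) < width.+1)%N.
  by rewrite ltnS (leq_trans (ltnW ltx)) // leq_pmull.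
have tw : twist None l0 = x.
  by rewrite /twist /= inordK ?nth_index ?mem_enum.
rewrite (rowE _ _ l0); have := e (rho (x, l0)).
have l0D : l0 \in layers None by rewrite inE /= inordK.
rewrite mem_imset // ![_ \in line _ _]inE layerE -[(x, l0).2]/l0 l0D tw mul1g.
rewrite eqxx.
by move/esym/eqP.
Qed.

End Lines.

(** * Coordinates given by odd functions *)

Section OddFunctions.
Variables (R : realType) (Y : finType) (s : Y -> Y).
Hypotheses (sK : involutive s) (s_neq : forall y, s y != y).

(** A transversal of the orbits of [s]; its size is the dimension of the space. *)
Definition reps : {set Y} := [set y | (enum_rank y < enum_rank (s y))%N]%SET.

Notation d := #|reps|.

Definition unitv (y : Y) : 'rV[R]_d :=
  \row_j ((y == enum_val j)%:R - (y == s (enum_val j))%:R).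

(** Reads a vector as an odd function on [Y], whose values on [reps] are the coordinates. *)
Definition ev (v : 'rV[R]_d) (y : Y) : R := dotv (unitv y) v.

Definition vec (f : Y -> R) : 'rV[R]_d := \row_j f (enum_val j).

Definition pullback (k : Y -> Y) (v : 'rV[R]_d) := vec (fun y => ev v (k y)).

Lemma eq_s y z : (s y == z) = (y == s z).
Proof. by rewrite (can2_eq sK sK). Qed.

Lemma reps_s y : (s y \in reps) = (y \notin reps).
Proof.
rewrite !inE sK ltn_neqAle -leqNgt.
case: eqP => // e; case/eqP: (s_neq y).
by apply: enum_rank_inj; apply: ord_inj.
Qed.

Lemma reps_gt0 (y : Y) : (0 < d)%N.
Proof.
apply/card_gt0P; have [yh|yh] := boolP (y \in reps); first by exists y.
by exists (s y); rewrite reps_s.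
Qed.

Lemma unitv_s y : unitv (s y) = - unitv y.
Proof.
by apply/rowP => j; rewrite !mxE opprB eq_s (inj_eq (can_inj sK)).
Qed.

Lemma ev_s v y : ev v (s y) = - ev v y.
Proof. by rewrite /ev unitv_s -scaleN1r dotvZl mulN1r. Qed.

Lemma evB v w y : ev (v - w) y = ev v y - ev w y.
Proof. exact: dotvBr. Qed.

Lemma unitv_enum_val j : unitv (enum_val j) = delta_mx 0 j.
Proof.
apply/rowP => i; rewrite !mxE /= (inj_eq enum_val_inj) eq_sym.
suff /negPf -> : enum_val j != s (enum_val i) by rewrite subr0.
apply: contraTneq (enum_valP j) => ->.
by rewrite reps_s negbK (enum_valP i).
Qed.

Lemma ev_enum_val v j : ev v (enum_val j) = v 0 j.
Proof.
rewrite /ev unitv_enum_val /dotv (bigD1 j) //= mxE !eqxx mul1r big1 ?addr0 //.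
by move=> i /negPf ij; rewrite mxE ij andbF mul0r.
Qed.

Lemma ev_inj v w : (forall y, ev v y = ev w y) -> v = w.
Proof. by move=> e; apply/rowP => j; rewrite -!ev_enum_val. Qed.

Lemma ev_vec f y : (forall z, f (s z) = - f z) -> ev (vec f) y = f y.
Proof.
move=> odd_f; have evh z : z \in reps -> ev (vec f) z = f z.
  by move=> zh; rewrite -(enum_rankK_in zh zh) ev_enum_val mxE.
have [/evh //|yh] := boolP (y \in reps).
by rewrite -[LHS]opprK -ev_s evh ?reps_s // odd_f opprK.
Qed.

Lemma ev_unitv y z : ev (unitv y) z = (y == z)%:R - (y == s z)%:R.
Proof.
rewrite -(@ev_vec (fun z => (y == z)%:R - (y == s z)%:R)) // => w.
by rewrite sK opprB.
Qed.

Lemma unitv_inj : injective unitv.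
Proof.
move=> y z e; have := ev_unitv y y; rewrite e ev_unitv eqxx -(eq_s y y).
rewrite (negPf (s_neq y)); have [-> //|_] := eqVneq z y.
by clear e; case: (z == s y) => /= h; exfalso; lra.
Qed.

Lemma dotv_ev v w : dotv v w = 2^-1 * \sum_y ev v y * ev w y.
Proof.
have -> : \sum_y ev v y * ev w y = 2 * \sum_(y in reps) ev v y * ev w y.
  rewrite (bigID (mem reps)) /= mulr2n mulrDl mul1r; congr (_ + _).
  rewrite (reindex_inj (can_inj sK)) /=; apply: eq_big => [y|y _].
    by rewrite reps_s negbK.
  by rewrite !ev_s mulrNN.
rewrite mulrA mulVf ?pnatr_eq0 // mul1r big_enum_val.
by apply: eq_bigr => j _; rewrite !ev_enum_val.
Qed.

Lemma ev_pullback k v y : (forall z, k (s z) = s (k z)) ->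
  ev (pullback k v) y = ev v (k y).
Proof. by move=> ks; rewrite ev_vec // => z; rewrite ks ev_s. Qed.

Lemma pullback_isometry k : (forall z, k (s z) = s (k z)) -> injective k ->
  Defs.isometry (pullback k).
Proof.
move=> ks k_inj; apply/isometryP => v w; rewrite !dotv_ev; congr (_ * _).
rewrite [RHS](reindex_inj k_inj); apply: eq_bigr => y _.
by rewrite !evB !ev_pullback.
Qed.

(** The squared distances from a point to a unit vector and to its negative differ by a multiple of
    one coordinate, so distances to the images of the [unitv y] determine [f x]. *)
Lemma isometry_ext f g :
  Defs.isometry f -> Defs.isometry g ->
  (forall y, f (unitv y) = g (unitv y)) ->
  (forall z, exists y, f (unitv y) = unitv z) -> f =1 g.
Proof.
move=> /isometryP isof /isometryP isog fg surj x; apply: ev_inj => z.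
have dist w : dotv (f x) (f x) - 2 * ev (f x) w =
              dotv (g x) (g x) - 2 * ev (g x) w.
  have [y fy] := surj w; have e := isof x (unitv y).
  have := isog x (unitv y); rewrite -e -fg fy !(dotvBl, dotvBr).
  by rewrite /ev !(dotvC _ (unitv w)) => h; lra.
by have := dist z; have := dist (s z); rewrite !ev_s => h1 h2; lra.
Qed.

End OddFunctions.

(** * The stacked cross-polytope *)

Section Stacked.
Variables (R : realType) (Y : finType) (s : Y -> Y) (HH : {set {set Y}}).
Hypotheses (sK : involutive s) (s_neq : forall y, s y != y).
Hypothesis HH_gt2 : forall T, T \in HH -> (2 < #|T|)%N.
Hypothesis HH_anti : forall T y, T \in HH -> y \in T -> s y \notin T.
Hypothesis HH_diff : forall T T', T \in HH -> T' \in HH -> T != T' ->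
  (#|T| <= #|T'|)%N -> (1 < #|T' :\: T|)%N.

Notation d := #|reps s|.
Notation blocks := (blocks HH).
Notation unitv := (@unitv R Y s).
Notation ev := (@ev R Y s).

Definition eps : R := (2 * (#|Y| ^ 2)%:R)^-1.

(* The strict concavity of the gauge keeps every block in convex position above
   the smaller blocks it contains; eps <= 1 / (2 |Y|^2) keeps it below all
   functionals that vanish somewhere on the block. *)
Definition gauge (t : nat) : R := t%:R - eps * (t * t.-1)%:R.

Definition pt (T : {set Y}) : 'rV[R]_d :=
  (gauge #|T|)^-1 *: \sum_(y in T) unitv y.

Definition verts : seq 'rV[R]_d := [seq pt T | T <- enum blocks].

Definition hull : set 'rV[R]_d := conv verts.

Lemma eps_gt0 (y : Y) : 0 < eps.
Proof.
have Y0 : (0 < #|Y|)%N by apply/card_gt0P; exists y.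
by rewrite invr_gt0 mulr_gt0 // ltr0n expn_gt0 Y0.
Qed.

Lemma eps_small (m : nat) : (m <= #|Y| ^ 2)%N -> eps * m%:R <= 1 / 2.
Proof.
move=> mY; have [->|m0] := posnP m; first by rewrite mulr0; lra.
have Y0 : (0 < (#|Y| ^ 2)%:R :> R) by rewrite ltr0n (leq_trans m0).
have le_m : (m%:R <= (#|Y| ^ 2)%:R :> R) by rewrite ler_nat.
rewrite /eps mulrC ler_pdivrMr; first by move: le_m; lra.
by rewrite mulr_gt0.
Qed.

Lemma gauge1 : gauge 1 = 1.
Proof. by rewrite /gauge /= muln0 mulr0 subr0. Qed.

Lemma gauge_lb (T : {set Y}) : #|T|%:R - 1 / 2 <= gauge #|T|.
Proof.
rewrite /gauge lerD2l lerN2; apply: eps_small.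
by rewrite expnS expn1 leq_mul ?max_card // (leq_trans (leq_pred _)) ?max_card.
Qed.

Lemma block_gt0 T : T \in blocks -> (0 < #|T|)%N.
Proof. by move=> /blocksP[[y ->]|/HH_gt2/ltnW/ltnW//]; rewrite cards1. Qed.

Lemma gauge_gt0 T : T \in blocks -> 0 < gauge #|T|.
Proof.
move=> /block_gt0 T0; apply: lt_le_trans (gauge_lb T).
by have : (1 : R) <= #|T|%:R; [rewrite ler1n|lra].
Qed.

Lemma pt_set1 y : pt [set y]%SET = unitv y.
Proof. by rewrite /pt cards1 gauge1 invr1 scale1r big_set1. Qed.

Lemma dotv_pt T a : dotv (pt T) a = (gauge #|T|)^-1 * \sum_(y in T) ev a y.
Proof. by rewrite dotvZl dotv_suml. Qed.

Lemma dotv_pt_le T a : T \in blocks ->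
  (dotv (pt T) a <= 1) = (\sum_(y in T) ev a y <= gauge #|T|).
Proof. by move=> /gauge_gt0 ?; rewrite dotv_pt mulrC ler_pdivrMr ?mul1r. Qed.

Lemma dotv_pt_lt T a : T \in blocks ->
  (dotv (pt T) a < 1) = (\sum_(y in T) ev a y < gauge #|T|).
Proof. by move=> /gauge_gt0 ?; rewrite dotv_pt mulrC ltr_pdivrMr ?mul1r. Qed.

Lemma dotv_pt_eq T a : T \in blocks ->
  \sum_(y in T) ev a y = gauge #|T| -> dotv (pt T) a = 1.
Proof. by move=> /gauge_gt0 T0 e; rewrite dotv_pt e mulVf ?gt_eqF. Qed.

Lemma pt_verts T : T \in blocks -> pt T \in verts.
Proof. by move=> TB; apply: map_f; rewrite mem_enum. Qed.

Lemma vertsP v : v \in verts -> exists2 T, T \in blocks & v = pt T.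
Proof. by move=> /mapP[T]; rewrite mem_enum => TB ->; exists T. Qed.

Lemma pt_hull T : T \in blocks -> hull (pt T).
Proof. by move=> /pt_verts/mem_conv. Qed.

(** Antisymmetrization of a weight. For nonnegative [h] it never exceeds [h], with equality at
    points whose antipode has weight zero. *)
Definition functional (h : Y -> R) : 'rV[R]_d :=
  vec s (fun y => h y - h (s y)).

Lemma ev_functional h y : ev (functional h) y = h y - h (s y).
Proof. by rewrite /functional ev_vec // => z; rewrite sK opprB. Qed.

Lemma functional_le (h : Y -> R) (T : {set Y}) : (forall y, 0 <= h y) ->
  \sum_(y in T) ev (functional h) y <= \sum_(y in T) h y.
Proof. by move=> h0; apply: ler_sum => y _; rewrite ev_functional gerBl. Qed.

Lemma functional_eq (h : Y -> R) (T : {set Y}) :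
  (forall y, y \in T -> h (s y) = 0) ->
  \sum_(y in T) ev (functional h) y = \sum_(y in T) h y.
Proof. by move=> h0; apply: eq_bigr => y yT; rewrite ev_functional h0 ?subr0. Qed.

(** The sum is at most [|V| - 1], while the gauge is at least [|V| - 1/2]. This disposes of blocks
    that leave the support of [h]. *)
Lemma sum_missing (h : Y -> R) (V : {set Y}) y :
  (forall z, h z <= 1) -> y \in V -> h y = 0 ->
  \sum_(z in V) h z < gauge #|V|.
Proof.
move=> h1 yV hy; apply: lt_le_trans (gauge_lb V).
rewrite (big_setD1 y) //= hy add0r.
have : \sum_(z in V :\ y) h z <= #|V :\ y|%:R.
  by rewrite -sum1_card natr_sum; apply: ler_sum.
by rewrite [#|V|](cardsD1 y) yV natrD /= => ?; lra.
Qed.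

Lemma pt_separated T : T \in blocks -> exists2 a, dotv (pt T) a = 1 &
  forall V, V \in blocks -> V != T -> dotv (pt V) a < 1.
Proof.
move=> TB; have T0 := block_gt0 TB.
have [y yT] : exists y, y \in T by apply/card_gt0P.
have e0 := eps_gt0 y.
(* This constant makes the sum over [T] equal to its gauge. On a block [V] properly inside [T] the
   deficit [eps * |V| * (|T| - 1)] exceeds the deficit [eps * |V| * (|V| - 1)] of the gauge. *)
pose h y : R := if y \in T then 1 - eps * #|T|.-1%:R else 0.
have eT : eps * #|T|.-1%:R <= 1 / 2.
  apply: eps_small; apply: leq_trans (leq_pred _) (leq_trans (max_card _) _).
  by rewrite expnS expn1 leq_pmulr //; apply/card_gt0P; exists y.
have h0 z : 0 <= h z by rewrite /h; case: ifP => _ //; lra.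
have sumT (V : {set Y}) : V \subset T ->
    \sum_(z in V) h z = #|V|%:R - eps * (#|V| * #|T|.-1)%:R.
  move=> VT; rewrite (eq_bigr (fun=> 1 - eps * #|T|.-1%:R)).
    by rewrite sumr_const -[LHS]mulr_natr natrM; ring.
  by move=> z /(fintype.subsetP VT) zT; rewrite /h zT.
exists (functional h).
  apply: dotv_pt_eq => //; rewrite functional_eq ?sumT // => z zT.
  by rewrite /h (negPf (blocks_anti s_neq HH_anti TB zT)).
move=> V VB neq; rewrite dotv_pt_lt //.
apply: le_lt_trans (functional_le _ h0) _.
have [VT|/fintype.subsetPn[z zV zT]] := boolP (V \subset T); last first.
  apply: (@sum_missing _ _ z) => //; last by rewrite /h (negPf zT).
  move=> w; rewrite /h; case: ifP => _; last by lra.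
  by rewrite gerBl mulr_ge0 ?ler0n // ltW.
rewrite sumT // /gauge ltrD2l ltrN2 ltr_pM2l // ltr_nat.
have : V \proper T.
  by rewrite finset.properEneq VT neq.
move/proper_card; have := block_gt0 VB.
by case: #|V| => // v _; case: #|T| => // t; rewrite ltn_pmul2l // ltnS.
Qed.

Lemma pt_inj : {in blocks &, injective pt}.
Proof.
move=> T V TB VB e; have [a aT lt] := pt_separated TB.
by apply/eqP; apply: contraT; rewrite eq_sym => /(lt _ VB); rewrite -e aT ltxx.
Qed.

Lemma pt_face T : T \in blocks -> face hull [set pt T]%classic.
Proof.
move=> TB; have [a aT lt] := pt_separated TB.
apply: (exposed_face (pt_verts TB) aT) => _ /vertsP[V VB ->] neq.
by apply: lt => //; apply: contraNneq neq => ->.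
Qed.

(** Differences of antipodal vertices of the cross-polytope are twice the standard basis vectors and
    already span. *)
Lemma rank_verts :
  \rank (\matrix_(i < size verts) (verts`_i - verts`_0)) = d.
Proof.
set A := \matrix_(i < _) _; apply/eqP; rewrite -/(row_full A) -sub1mx.
apply/row_subP => j.
have rowA y : (unitv y - verts`_0 <= A)%MS.
  have yv : unitv y \in verts by rewrite -pt_set1 pt_verts ?set1_blocks.
  have iy := yv; rewrite -index_mem in iy.
  have -> : unitv y - verts`_0 = row (Ordinal iy) A.
    by rewrite rowK /= nth_index.
  exact: row_sub.
have -> : row j 1%:M = 2^-1 *: ((unitv (enum_val j) - verts`_0) -
                               (unitv (s (enum_val j)) - verts`_0)).
  rewrite opprB addrA subrK unitv_s // opprK unitv_enum_val // row1.
  by rewrite -mulr2n -scaler_nat scalerA mulVf ?pnatr_eq0 // scale1r.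
by rewrite scalemx_sub // addmx_sub // -scaleN1r scalemx_sub.
Qed.

Lemma gauge_dotv T a : T \in blocks ->
  gauge #|T| * dotv (pt T) a = \sum_(y in T) ev a y.
Proof.
by move=> TB; rewrite dotv_pt mulrA mulfV ?mul1r // gt_eqF ?gauge_gt0.
Qed.

(* At a sign conflict the two vertices cancel a coordinate, so a positive
   combination of them lies in the interior of the hull. *)
Lemma conflict_full T T' y F : T \in blocks -> T' \in blocks ->
  y \in T -> s y \in T' -> face hull F -> F (pt T) -> F (pt T') -> F = hull.
Proof.
move=> TB T'B yT syT' [a [b [le ->]]] [_ aT] [_ aT'].
have evb z : ev a z <= b.
  by have := le _ (pt_hull (set1_blocks HH z)); rewrite pt_set1.
(* The other points of [V] contribute at most [b] each and the gauge is at least [|V| - 1/2], so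
   [ev a z >= b / 2] on a tight block. *)
have sumb (V : {set Y}) z : V \in blocks -> z \in V -> dotv (pt V) a = b ->
    (#|V|%:R - 1 / 2) * b <= ev a z + (#|V|%:R - 1) * b.
  move=> VB zV aV; apply: (@le_trans _ _ (gauge #|V| * b)).
    apply: ler_wpM2r; last exact: gauge_lb.
    by have := evb z; have := evb (s z); rewrite ev_s //; lra.
  rewrite -aV gauge_dotv // aV (big_setD1 z) //= lerD2l.
  have -> : #|V|%:R - 1 = #|V :\ z|%:R :> R.
    by rewrite [#|V|](cardsD1 z) zV add1n -natr1 addrK.
  rewrite mulr_natl -sumr_const; exact: ler_sum.
(* The values at [y] and [s y] sum to zero; both are at least [b / 2] and at most [b]. *)
have b0 : b = 0.
  have := sumb _ _ TB yT aT; have := sumb _ _ T'B syT' aT'; rewrite ev_s //.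
  by have := evb y; have := evb (s y); rewrite ev_s //; lra.
have -> : a = 0.
  apply: (ev_inj sK s_neq) => z; have := evb z; have := evb (s z).
  by rewrite !ev_s // b0 {4}/ev dotvC dotv0l; lra.
apply/seteqP; split=> [x []//|x Px] /=.
by split; rewrite // b0 dotvC dotv0l.
Qed.

Lemma proper_functional (a : 'rV[R]_d) z :
  (forall V, V \in blocks -> dotv (pt V) a <= 1) -> ev a z = 1 ->
  exists F, [/\ face hull F, F <> hull &
    forall V, V \in blocks -> dotv (pt V) a = 1 -> F (pt V)].
Proof.
move=> le az; exists [set x | hull x /\ dotv x a = 1]%classic; split.
- exists a, 1; split=> // x; apply: conv_dot_le => _ /vertsP[V VB ->].
  exact: le.
- move=> e; have : hull (pt [set s z]%SET) by apply/pt_hull/set1_blocks.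
  rewrite -e pt_set1 => -[_]; rewrite -/(ev a _) ev_s // az; lra.
- by move=> V VB aV; split=> //; apply: pt_hull.
Qed.

Lemma compatible_face z T : T \in blocks -> s z \notin T ->
  exists F, [/\ face hull F, F <> hull, F (pt [set z]%SET) & F (pt T)].
Proof.
move=> TB szT; have T0 := block_gt0 TB; have e0 := eps_gt0 z.
(* The functional h is 1 at z and 1 - beta on the rest of T, with beta such that
   the sum over T is the gauge of T. *)
pose q := (if z \in T then #|T| else #|T|.-1)%N.
(* The deficit [eps * |T| * (|T| - 1)] is shared by the points of [T] other than [z]: [|T| - 1] of
   them if [z] is in [T], and [|T|] otherwise. *)
pose beta := eps * q%:R.
have beta1 : beta <= 1 / 2.
  apply: eps_small; apply: (@leq_trans #|T|).
    by rewrite /q; case: ifP => // _; apply: leq_pred.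
  apply: leq_trans (max_card _) _.
  by rewrite expnS expn1 leq_pmulr //; apply/card_gt0P; exists z.
have beta0 : 0 <= beta by rewrite mulr_ge0 ?ler0n // ltW.
pose h y : R := if y == z then 1 else if y \in T then 1 - beta else 0.
have h0 y : 0 <= h y by rewrite /h; do 2!case: ifP => _ //; lra.
have h1 y : h y <= 1 by rewrite /h; do 2!case: ifP => _ //; lra.
have sumh (V : {set Y}) : V \subset z |: T ->
    \sum_(y in V) h y = #|V|%:R - eps * (q * #|V :\ z|)%:R.
  move=> VT; have sumz : \sum_(y in V :\ z) h y = (1 - beta) * #|V :\ z|%:R.
    rewrite mulr_natr -sumr_const; apply: eq_bigr => y.
    rewrite 2!inE => /andP[yz /(fintype.subsetP VT)].
    by rewrite 2!inE /h (negPf yz) /= => ->.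
  have [zV|zV] := boolP (z \in V).
    rewrite (big_setD1 z) //= sumz /h eqxx [#|V|](cardsD1 z) zV natrD natrM /beta.
    by rewrite /=; ring.
  have Vz : V :\ z = V by apply/finset.setDidPl; rewrite disjoint_sym disjoints1.
  by rewrite -{1}Vz sumz Vz natrM /beta; ring.
have hT y : y \in T -> h (s y) = 0.
  move=> yT; rewrite /h (negPf (blocks_anti s_neq HH_anti TB yT)).
  by case: eqP => // e; move: szT; rewrite -e sK yT.
have aT : dotv (pt T) (functional h) = 1.
  apply: dotv_pt_eq => //; rewrite functional_eq // sumh ?finset.subsetUr //.
  rewrite /gauge; congr (_ - eps * _%:R); rewrite /q.
  by case: ifP => zT; rewrite (cardsD1 z T) zT ?add1n ?add0n // mulnC.
have az : ev (functional h) z = 1.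
  rewrite ev_functional {1}/h eqxx /h (negPf szT) (negPf (s_neq z)).
  by rewrite subr0.
have [|F [fF pF sF]] := proper_functional (a := functional h) _ az.
  move=> V VB; rewrite dotv_pt_le //.
  have [->|VT] := eqVneq V T; first by rewrite -gauge_dotv // aT mulr1.
  apply: le_trans (functional_le _ h0) _.
  have [[y ->]|VH] := blocksP VB; first by rewrite big_set1 cards1 gauge1.
  have [sub|/fintype.subsetPn[y yV]] := boolP (V \subset z |: T); last first.
    rewrite 2!inE negb_or => /andP[yz yT]; apply/ltW/(@sum_missing _ _ y) => //.
    by rewrite /h (negPf yz) (negPf yT).
  rewrite sumh // /gauge lerD2l lerN2 ler_pM2l // ler_nat.
  have VT1 : (#|V :\: T| <= 1)%N.
    rewrite -(cards1 z); apply/subset_leq_card/fintype.subsetP => y.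
    rewrite !inE => /andP[yT /(fintype.subsetP sub)].
    by rewrite !inE (negPf yT) orbF.
  have [zT|zT] := boolP (z \in T); rewrite /q ?zT ?(negPf zT).
    have leVT : (#|V| <= #|T|)%N.
      apply/subset_leq_card; apply: fintype.subset_trans sub _.
      by rewrite finset.subUset finset.sub1set zT fintype.subxx.
    apply: leq_mul => //; rewrite [#|V|](cardsD1 z); case: (z \in V) => //=.
    exact: leq_pred.
  have [zV|zV] := boolP (z \in V).
    (* Here [V] has a single point outside [T], so [HH_diff] forces it to be strictly smaller than
       [T]. *)
    suff ltVT : (#|V| < #|T|)%N.
      rewrite leq_mul //; first by case: #|T| ltVT.
      by rewrite [#|V|](cardsD1 z) zV.
    have [[y Ty]|TH] := blocksP TB.
      have := HH_gt2 VH; have := subset_leq_card sub.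
      by rewrite Ty cardsU1 cards1; case: (z \notin _) => /=; lia.
    rewrite ltnNge; apply/negP => /(HH_diff TH VH).
    by rewrite eq_sym ltnNge VT1 => /(_ VT).
  have Vz : V :\ z = V by apply/finset.setDidPl; rewrite disjoint_sym disjoints1.
  rewrite Vz mulnC leq_mul //.
  suff : (#|V| <= #|T|)%N by case: #|V| => [|v]; case: #|T|.
  apply/subset_leq_card/fintype.subsetP => y yV.
  have := fintype.subsetP sub _ yV; rewrite !inE => /orP[/eqP e|//].
  by rewrite -e yV in zV.
exists F; split=> //; apply: sF => //; first exact: set1_blocks.
by rewrite pt_set1.
Qed.

(** * From maps of faces to permutations of [Y] *)

Definition compatible T T' : bool :=
  `[< exists F, [/\ face hull F, F <> hull, F (pt T) & F (pt T')] >].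

(** Common ground of symmetries, acting by images, and combinatorial automorphisms, so that one
    recovery argument serves both. *)
Definition facial (alpha : set 'rV[R]_d -> set 'rV[R]_d) : Prop :=
  [/\ forall F, face hull F -> face hull (alpha F),
      forall F F', face hull F -> face hull F' ->
        ((F `<=` F')%classic <-> (alpha F `<=` alpha F')%classic) &
      forall T, T \in blocks -> exists2 T', T' \in blocks &
        alpha [set pt T]%classic = [set pt T']%classic].

Lemma face_hull F : face hull F -> (F `<=` hull)%classic.
Proof. by move=> [a [b [_ ->]]] x []. Qed.

Lemma facial_perm alpha : facial alpha -> exists rho : Y -> Y,
  [/\ injective rho, {in HH, forall T : {set Y}, (rho @: T)%SET \in HH} &
      {in blocks, forall T : {set Y},
         alpha [set pt T]%classic = [set pt (rho @: T)%SET]%classic}].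
Proof.
move=> [alphaF alphaS alphaV].
have /choice[p hp] T : exists T', T \in blocks ->
    T' \in blocks /\ alpha [set pt T]%classic = [set pt T']%classic.
  have [/alphaV[T' T'B e]|_] := boolP (T \in blocks); last by exists T.
  by exists T'.
have pB T : T \in blocks -> p T \in blocks by move=> /hp[].
have pE T : T \in blocks -> alpha [set pt T]%classic = [set pt (p T)]%classic.
  by move=> /hp[].
have p_inj : {in blocks &, injective p}.
  move=> T V TB VB e; apply: pt_inj => //.
  suff : ([set pt T] `<=` [set pt V])%classic by apply.
  by apply/alphaS; rewrite ?pE ?e //; apply: pt_face.
have p_mem T F : T \in blocks -> face hull F -> F (pt T) -> alpha F (pt (p T)).
  move=> TB fF FT; have /alphaS : ([set pt T] `<=` F)%classic by move=> _ ->.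
  by rewrite pE // => /(_ (pt_face TB) fF); apply.
have conflict T T' y : T \in blocks -> T' \in blocks -> y \in T -> s y \in T' ->
    ~~ compatible T T'.
  move=> TB T'B yT syT'; apply/asboolP => -[F [fF nF FT FT']].
  exact/nF/(conflict_full TB T'B yT syT').
have compat z T : T \in blocks -> s z \notin T -> compatible [set z]%SET T.
  by move=> TB szT; apply/asboolP; apply: compatible_face.
have p_comp : {in blocks &, forall T T',
    compatible T T' -> compatible (p T) (p T')}.
  move=> T T' TB T'B /asboolP[F [fF nF FT FT']]; apply/asboolP.
  exists (alpha F); split; [exact: alphaF| |exact: p_mem|exact: p_mem].
  (* If [alpha F] were the whole hull it would contain [alpha hull], so [F] would contain the
     hull. *)
  move=> e; apply: nF; apply/seteqP; split; first exact: face_hull.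
  apply/alphaS => //; first exact: face_full.
  by rewrite e; apply/face_hull/alphaF/face_full.
have [rho [rho_inj rhoE rhoH]] :=
  blocks_recover sK HH_gt2 conflict compat pB p_inj p_comp.
by exists rho; split=> // T TB; rewrite pE // rhoE.
Qed.

Lemma symmetry_facial f :
  symmetry_of hull f -> facial (fun F => (f @` F)%classic).
Proof.
move=> symf; have f_inj := isometry_inj (proj1 symf); split.
- by move=> F; apply: isometry_face.
- move=> F F' _ _; split=> [FF' _ [x Fx <-]|FF' x Fx]; first by exists x; auto.
  by have [y F'y /f_inj <-] := FF' (f x) (ex_intro2 _ _ x Fx erefl).
move=> T TB; have fT := isometry_face symf (pt_face TB).
have [|v /vertsP[V VB ->] [x -> e]] := face_vertex (x := f (pt T)) fT.
  by exists (pt T).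
exists V => //; rewrite -e; apply/seteqP; split=> [_ [y -> <-]//|_ ->] /=.
by exists (pt T).
Qed.

(** The empty face is the only one with empty image. Hence the image of [{pt T}] contains some
    vertex [pt V], and the face [F] sent to [{pt V}] is a nonempty part of [{pt T}], so all of
    it. *)
Lemma comb_aut_facial alpha : comb_aut hull alpha -> facial alpha.
Proof.
move=> [alphaF alphaO alphaS]; split=> // T TB.
have fT := pt_face TB; have f0 : face hull set0.
  exists 0, 1; split=> [x _|]; first by rewrite dotvC dotv0l.
  apply/seteqP; split=> [//|x [_]]; rewrite dotvC dotv0l => /eqP.
  by rewrite eq_sym oner_eq0.
have alpha0 F : face hull F -> (alpha F `<=` set0)%classic -> F = set0.
  move=> fF aF; apply/seteqP; split=> //; apply/alphaS => //.
  by move=> x /aF.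
have [x aTx] : exists x, alpha [set pt T]%classic x.
  apply: contrapT => /forallNP h.
  by have : set0 (pt T) by rewrite -(alpha0 _ fT) // => x /h.
have [v /vertsP[V VB ->] aTV] := face_vertex (alphaF _ fT) aTx.
exists V => //; have [F fF eF] := alphaO _ (pt_face VB).
rewrite -eF; congr alpha; apply/seteqP.
have FT : (F `<=` [set pt T])%classic by apply/alphaS => //; rewrite eF => _ ->.
split=> // _ ->; have [y Fy] : exists y, F y.
  apply: contrapT => /forallNP h; have F0 : F = set0 by apply/seteqP; split.
  have [E fE aE] := alphaO _ f0.
  have : set0 (pt V); last by [].
  by rewrite -aE (alpha0 E) ?aE // -F0 eF.
by rewrite -(FT _ Fy).
Qed.

(** * Permutations of [Y] acting on the hull *)

Section Action.
Variables k k' : Y -> Y.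
Hypotheses (kK : cancel k k') (k'K : cancel k' k).
Hypothesis ks : forall y, k (s y) = s (k y).

Lemma pullback_unitv y : pullback k (unitv y) = unitv (k' y).
Proof.
apply: (ev_inj sK s_neq) => z; rewrite ev_pullback // !ev_unitv // -ks.
by rewrite -!(can2_eq k'K kK).
Qed.

Lemma pullback_comb (I : Type) (r : seq I) (p : pred I) (w : I -> R)
    (x : I -> 'rV[R]_d) :
  pullback k (\sum_(i <- r | p i) w i *: x i) =
  \sum_(i <- r | p i) w i *: pullback k (x i).
Proof.
apply: (ev_inj sK s_neq) => z; rewrite ev_pullback //.
rewrite /ev !(dotvC (unitv _)) !dotv_suml; apply: eq_bigr => i _.
by rewrite !dotvZl !(dotvC _ (unitv _)) -!/(ev _ _) ev_pullback.
Qed.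

Lemma pullback_pt T : pullback k (pt T) = pt (k' @: T)%SET.
Proof.
have k'_inj := can_inj k'K.
rewrite /pt card_imset // scaler_sumr pullback_comb big_imset //=;
  last by move=> ? ? _ _ /k'_inj.
by rewrite scaler_sumr; apply: eq_bigr => y _; rewrite pullback_unitv.
Qed.

Hypothesis k'_HH : {in HH, forall T : {set Y}, (k' @: T)%SET \in HH}.

Lemma imset_blocks T : T \in blocks -> (k' @: T)%SET \in blocks.
Proof.
move=> /blocksP[[y ->]|/k'_HH TH]; first by rewrite imset_set1 set1_blocks.
by rewrite inE TH orbT.
Qed.

Lemma pullback_hull x : hull x -> hull (pullback k x).
Proof.
move=> [w [w0 [w1 ->]]]; rewrite pullback_comb; apply: conv_comb => // i.
have /vertsP[T TB ->] : verts`_i \in verts by rewrite mem_nth.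
by rewrite pullback_pt; apply/pt_hull/imset_blocks.
Qed.

End Action.

End Stacked.

(** * Realization of the group *)

Local Open Scope classical_set_scope.

Section Realization.
Variables (R : realType) (G : finGroupType) (sigma : G).
Hypotheses (sigma2 : (sigma * sigma = 1)%g) (sigma1 : sigma != 1%g).
Hypothesis sigmaC : forall x, commute sigma x.

Let s := antipode sigma.
Let HH := lines G.
Let sK : involutive s := antipodeK sigma2.
Let s_neq : forall y, s y != y := antipode_neq sigma1.
Let HH_gt2 : forall T, T \in HH -> (2 < #|T|)%N := lines_gt2 sigma1.
Let HH_anti : forall T y, T \in HH -> y \in T -> s y \notin T :=
  lines_anti sigma1.
Let HH_diff := lines_diff sigma1.

Notation P := (@hull R _ s HH).
Implicit Types h : G.

Notation pt := (@pt R _ s).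

(** The inverse makes [e_y] move to [e_(h y)] and keeps [act] from reversing products. *)
Definition act (h : G) : 'rV[R]_#|reps s| -> 'rV[R]_#|reps s| :=
  pullback (translate h^-1%g).

Lemma translateK h : cancel (translate h) (translate h^-1%g).
Proof. by case=> x l; rewrite /translate /= mulKg. Qed.

Lemma translateVK h : cancel (translate h^-1%g) (translate h).
Proof. by case=> x l; rewrite /translate /= mulKVg. Qed.

(** Both maps multiply on the left, so this is where centrality of [sigma] enters. *)
Lemma translate_s h y : translate h (s y) = s (translate h y).
Proof. by rewrite /translate /s /antipode /= !mulgA sigmaC. Qed.

Lemma ev_act h v y : ev (act h v) y = ev v (translate h^-1%g y).
Proof. by rewrite ev_pullback // => z; apply: translate_s. Qed.

Lemma actM g h : act (g * h)%g = act g \o act h.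
Proof.
apply/funext => v; apply: (ev_inj sK s_neq) => y; rewrite /= !ev_act.
by rewrite /translate /= invMg !mulgA.
Qed.

Lemma act1 v : act 1%g v = v.
Proof.
apply: (ev_inj sK s_neq) => -[x l].
by rewrite ev_act /translate /= invg1 mul1g.
Qed.

Lemma act_unitv h y : act h (unitv R s y) = unitv R s (translate h y).
Proof.
apply: (pullback_unitv R sK s_neq (translateVK h) (translateK h)).
exact: translate_s.
Qed.

Lemma act_pt h T : act h (pt T) = pt (translate h @: T)%SET.
Proof.
apply: (pullback_pt R sK s_neq (translateVK h) (translateK h)).
exact: translate_s.
Qed.

Lemma act_inj : injective act.
Proof.
move=> g h e; pose y : site G := (1%g, (ord0, ord0)).
have : act g (unitv R s y) = act h (unitv R s y) by rewrite e.
rewrite !act_unitv => /(unitv_inj sK s_neq)[].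
by rewrite !mulg1.
Qed.

Lemma act_sigma : act sigma = (fun v => - v).
Proof.
apply/funext => v; apply: (ev_inj sK s_neq) => y; rewrite ev_act.
have -> : translate sigma^-1%g y = s y.
  by rewrite /translate -(mulgI _ _ _ (etrans sigma2 (esym (mulgV sigma)))).
by rewrite ev_s // -[in RHS]sub0r evB {2}/ev dotvC dotv0l sub0r.
Qed.

Lemma act_isometry h : Defs.isometry (act h).
Proof.
apply: pullback_isometry => //; first exact: translate_s.
exact: can_inj (translateVK h).
Qed.

Lemma act_hull h x : P x -> P (act h x).
Proof.
apply: (pullback_hull sK s_neq (translateVK h) (translateK h)).
  exact: translate_s.
by move=> T; apply: translate_lines.
Qed.

Lemma act_symmetry h : symmetry_of P (act h).
Proof.
split; first exact: act_isometry.
apply/seteqP; split=> [_ [x Px <-]|x Px]; first exact: act_hull.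
exists (act h^-1%g x); first exact: act_hull.
by rewrite -[LHS]/((act h \o act h^-1%g) x) -actM mulgV act1.
Qed.

Lemma facial_act alpha : facial HH alpha -> exists h : G,
  {in blocks HH, forall T : {set site G},
     alpha [set pt T] = [set act h (pt T)]}.
Proof.
move=> /(facial_perm sK s_neq HH_gt2 HH_anti HH_diff)[rho [rho_inj rhoH rhoE]].
have [h rhoh] := lines_rigid sigma1 rho_inj rhoH.
exists h => T TB; rewrite rhoE // act_pt; congr ([set pt _]).
exact: eq_imset.
Qed.

Lemma symmetry_act f : symmetry_of P f -> exists h, act h = f.
Proof.
move=> symf; have [h fh] :=
  facial_act (symmetry_facial sK s_neq HH_gt2 HH_anti symf).
exists h; apply/funext => x.
have act_f y : act h (unitv R s y) = f (unitv R s y).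
  have := fh _ (set1_blocks HH y); rewrite pt_set1 image_set1 => e.
  by have : [set f (unitv R s y)] (f (unitv R s y)) by []; rewrite e => ->.
apply: (isometry_ext sK s_neq (act_isometry h) (proj1 symf) act_f) => z.
by exists (translate h^-1%g z); rewrite act_unitv translateVK.
Qed.

Lemma realization : exists d : nat, (0 < d)%N /\
  exists P : set 'rV[R]_d,
    [/\ dpolytope P, centrally_symmetric P &
    exists phi : G -> ('rV[R]_d -> 'rV[R]_d),
      [/\ forall x y, phi (x * y)%g = phi x \o phi y,
          injective phi,
          forall f, symmetry_of P f <-> exists x, phi x = f,
          phi sigma = (fun x => - x) &
          (forall f g, symmetry_of P f -> symmetry_of P g ->
             (forall F, face P F -> f @` F = g @` F) -> f = g) /\
          (forall alpha, comb_aut P alpha ->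
             exists2 f, symmetry_of P f & induces P f alpha)]].
Proof.
pose y0 : site G := (1%g, (ord0, ord0)).
exists #|reps s|; split; first exact: reps_gt0 sK s_neq y0.
exists P; split.
- exists (verts R s HH); split=> //; exact: (rank_verts R HH sK s_neq).
- move=> x; have actN z : act sigma z = - z by rewrite act_sigma.
  by split=> /(act_hull sigma); rewrite actN ?opprK.
exists act; split.
- exact: actM.
- exact: act_inj.
- move=> f; split; first exact: symmetry_act.
  by move=> [h <-]; apply: act_symmetry.
- exact: act_sigma.
split.
  move=> f g /symmetry_act[a <-] /symmetry_act[b <-] e; congr act.
  (* The image of the single vertex at [y0] already determines the group element. *)
  have fy := pt_face R sK s_neq HH_gt2 HH_anti (set1_blocks HH y0).
  have := e _ fy; rewrite !image_set1 pt_set1 !act_unitv => eab.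
  have : [set unitv R s (translate a y0)] (unitv R s (translate a y0)) by [].
  by rewrite eab => /(unitv_inj sK s_neq)[]; rewrite !mulg1.
move=> alpha aut; have fac := comb_aut_facial sK s_neq HH_gt2 HH_anti aut.
have [h alphaE] := facial_act fac; have [alphaF alphaS _] := fac.
exists (act h) => [|F fF]; first exact: act_symmetry.
have fhF := isometry_face (act_symmetry h) fF.
(* [alpha F] and the image of [F] under [act h] contain the same vertices, hence are equal by
   [face_sub]. *)
have iff_pt T : T \in blocks HH -> alpha F (act h (pt T)) <-> F (pt T).
  move=> TB; have fT := pt_face R sK s_neq HH_gt2 HH_anti TB; split=> [aFT|FT].
    have : [set pt T] `<=` F by apply/alphaS; rewrite ?alphaE // => _ ->.
    exact.
  have /alphaS : [set pt T] `<=` F by move=> _ ->.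
  by move=> /(_ fT fF); rewrite alphaE //; apply.
have vertE v : v \in verts R s HH ->
    exists2 T, T \in blocks HH & v = act h (pt T).
  move=> /vertsP[T TB ->]; exists (translate h^-1%g @: T)%SET.
    by apply: imset_blocks TB => V; apply: translate_lines.
  by rewrite act_pt -imset_comp (eq_imset _ (translateVK h)) imset_id.
apply/seteqP; split.
  apply: (face_sub (alphaF _ fF) fhF) => _ /vertE[T TB ->] /(iff_pt _ TB) FT.
  by exists (pt T).
apply: (face_sub fhF (alphaF _ fF)) => _ /vertE[T TB ->] [x Fx].
move=> /(isometry_inj (act_isometry h)) e.
by apply/iff_pt; rewrite // -e.
Qed.

End Realization.

Theorem theorem4 (R : realType) (gT : finGroupType) (Gam : {group gT})
  (sigma : gT) :
  abelian Gam -> ~~ odd #|Gam| -> sigma \in Gam -> #[sigma]%g = 2%N ->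
  exists d : nat, (0 < d)%N /\
  exists P : set 'rV[R]_d,
    [/\ dpolytope P, centrally_symmetric P &
    exists phi : gT -> ('rV[R]_d -> 'rV[R]_d),
      [/\ (* phi is an isomorphism Gam -> G(P) *)
          {in Gam &, forall x y, phi (x * y)%g = phi x \o phi y},
          {in Gam &, injective phi},
          (forall f, symmetry_of P f <-> exists2 x, x \in Gam & phi x = f),
          (* sigma corresponds to the central symmetry *)
          phi sigma = (fun x => - x) &
          (* the natural map G(P) -> Gamma(P) is an isomorphism *)
          (forall f g, symmetry_of P f -> symmetry_of P g ->
             (forall F, face P F -> f @` F = g @` F) -> f = g) /\
          (forall alpha, comb_aut P alpha ->
             exists2 f, symmetry_of P f & induces P f alpha)]].
Proof.
move=> abG _ sG osigma.
(* [realization] concerns a whole group type, so it is applied to the type of elements of [Gam]. *)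
have s2 : (subg Gam sigma * subg Gam sigma = 1)%g.
  by rewrite -subgM // -expg2 -osigma expg_order morph1.
have s1 : subg Gam sigma != 1%g.
  apply/eqP => e; have := @subgK _ Gam sigma sG; rewrite e => /esym s1.
  by move: osigma; rewrite s1 order1.
have sC x : commute (subg Gam sigma) x.
  by apply: val_inj; apply: (centsP abG); rewrite ?subgP.
have [d [d0 [P [dP cP [phi [phiM phi_inj phiP phis phiG]]]]]] :=
  realization R s2 s1 sC.
exists d; split=> //; exists P; split=> //.
exists (phi \o subg Gam); split=> //=.
- by move=> x y xG yG; rewrite subgM.
- by move=> x y xG yG /phi_inj/(congr1 val); rewrite !subgK.
- move=> f; split=> [/phiP[x <-]|[x _ <-]]; last first.
    by apply/phiP; exists (subg Gam x).
  by exists (sgval x); rewrite ?subgP ?sgvalK.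
Qed.
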